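(* Suppose that $A\in C^0(\mathbb{R},\mathrm{SL}(2,\mathbb{R}))\cap C^2(\mathbb{R},\mathbb{M}^2)$, $\lambda\in C^0(\mathbb{R},\mathbb{R})$, $c_0\in\mathbb{R}$, and $\kappa=c_0^2$. Define $$u(t,x)=\dot A(t)A(t)^{-1}x,\qquad b(t,x)=c_0A(t)ZA(t)^{-1}x,\qquad p(t,x)=\tfrac12\lambda(t)\left[1-|A(t)^{-1}x|^2\right],$$ and $\Omega(t)=A(t)\mathcal{B}$. Then $u,b,p$ solve the MHD system $$D_tu=-\nabla p+b\cdot\nabla b,\qquad D_tb=b\cdot\nabla u,\qquad \nabla\cdot u=\nabla\cdot b=0\qquad\text{for }x\in\Omega(t),\ t\in\mathbb{R},$$ together with the boundary conditions $p=0$ and $b\cdot n=0$ on $\partial\Omega(t)$, if and only if $$\ddot A(t)+\kappa A(t)=\lambda(t)\,\mathrm{cof}\,A(t)\qquad\text{for all }t\in\mathbb{R}.$$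
   Context: $\mathbb{M}^2$ is the space of real $2\times2$ matrices and $\mathrm{SL}(2,\mathbb{R})=\{A\in\mathbb{M}^2:\det A=1\}$. $Z=\begin{bmatrix}0&-1\\1&0\end{bmatrix}$. $\mathrm{cof}\,A=ZAZ^\top$ is the cofactor matrix of $A$, so $\mathrm{cof}\,A=A^{-\top}$ if $\det A=1$. $\mathcal{B}\subset\mathbb{R}^2$ is the (closed) unit disk, so $\Omega(t)=\{x\in\mathbb{R}^2:|A(t)^{-1}x|^2\le1\}$. $n$ is the normal to $\partial\Omega(t)$. $D_t=\partial_t+u\cdot\nabla$ is the material derivative. The free boundary $\partial\Omega(t)$ moves with the fluid. Dots over $A$ denote time derivatives, and $|\cdot|$ on $\mathbb{R}^2$ is the Euclidean norm. *)

(* Defs.v *)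
From HB Require Import structures.
From mathcomp Require Import all_boot all_order all_algebra.
From mathcomp Require Import all_classical all_reals all_analysis.
From mathcomp Require Import ring.

Set Implicit Arguments.
Unset Strict Implicit.
Unset Printing Implicit Defensive.

Import Order.TTheory GRing.Theory Num.Theory.
Import numFieldNormedType.Exports.

Local Open Scope classical_set_scope.
Local Open Scope ring_scope.

Section Euclidean_plane.
Context {R : realType}.
Implicit Types (x y nu v : 'cV[R]_2) (S : set 'cV[R]_2) (M : 'M[R]_2).

Definition dot x y : R := \sum_(i < 2) x i 0 * y i 0.

(* The norm `|x| of the library on matrices is the sup norm. It induces the
   same topology and the same derivatives, but not the same unit disk. *)
Definition enorm x : R := Num.sqrt (dot x x).

Definition unit_disk : set 'cV[R]_2 := [set x | enorm x <= 1].

(* Z = [0 -1; 1 0] *)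
Definition Zmx : 'M[R]_2 := delta_mx 1 0 - delta_mx 0 1.

Definition cof M : 'M[R]_2 := Zmx *m M *m Zmx^T.

Definition boundary S : set 'cV[R]_2 := closure S `\` interior S.

Definition tangent_at S x v : Prop :=
  exists gamma : R -> 'cV[R]_2,
    [/\ gamma 0 = x, \forall s \near (0 : R), S (gamma s)
      & is_derive (0 : R) 1 gamma v].

(* The orientation of nu is left free: the boundary condition b . nu = 0 does
   not depend on it. *)
Definition unit_normal_at S x nu : Prop :=
  enorm nu = 1 /\ forall v, tangent_at S x v -> dot nu v = 0.

End Euclidean_plane.

Section Regularity.
Context {R : realType}.

Definition C2_path (A : R -> 'M[R]_2) : Prop :=
  [/\ forall t, derivable A t 1, forall t, derivable A^`()%classic t 1
    & continuous A^`()^`()%classic].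

End Regularity.

Section MHD.
Context {R : realType}.
Implicit Types (u b f : R -> 'cV[R]_2 -> 'cV[R]_2) (p : R -> 'cV[R]_2 -> R).

Definition base (j : 'I_2) : 'cV[R]_2 := delta_mx j 0.

Definition grad (q : 'cV[R]_2 -> R) (x : 'cV[R]_2) : 'cV[R]_2 :=
  \col_(j < 2) 'D_(base j) q x.

Definition divergence (w : 'cV[R]_2 -> 'cV[R]_2) (x : 'cV[R]_2) : R :=
  \sum_(j < 2) 'D_(base j) (fun y => w y j 0) x.

(* (w . nabla) g *)
Definition advect (w g : 'cV[R]_2 -> 'cV[R]_2) (x : 'cV[R]_2) : 'cV[R]_2 :=
  \sum_(j < 2) w x j 0 *: 'D_(base j) g x.

Definition material_derivative u f (t : R) (x : 'cV[R]_2) : 'cV[R]_2 :=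
  (fun s => f s x)^`()%classic t + advect (u t) (f t) x.

(* 'D and derive1 are total, with meaningless values where the limit of the
   difference quotients does not exist; a classical solution also has to have
   the derivatives that occur in the system. *)
Definition MHD_regular_at u b p (t : R) (x : 'cV[R]_2) : Prop :=
  [/\ derivable (fun s => u s x) t 1, derivable (fun s => b s x) t 1,
      differentiable (u t) x, differentiable (b t) x
    & differentiable (p t) x].

Definition MHD_equations_at u b p (t : R) (x : 'cV[R]_2) : Prop :=
  [/\ material_derivative u u t x = - grad (p t) x + advect (b t) (b t) x,
      material_derivative u b t x = advect (b t) (u t) x,
      divergence (u t) x = 0
    & divergence (b t) x = 0].

Definition MHD_boundary_at b p (Omega : R -> set 'cV[R]_2)
    (t : R) (x : 'cV[R]_2) : Prop :=
  p t x = 0 /\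
  forall nu, unit_normal_at (boundary (Omega t)) x nu -> dot (b t x) nu = 0.

Definition MHD_solution u b p (Omega : R -> set 'cV[R]_2) : Prop :=
  (forall t x, Omega t x ->
     MHD_regular_at u b p t x /\ MHD_equations_at u b p t x) /\
  (forall t x, boundary (Omega t) x -> MHD_boundary_at b p Omega t x).

End MHD.

Section Ellipse_normal.
Context {R : realType}.
Implicit Types (M : 'M[R]_2) (x y v : 'cV[R]_2).

Lemma dot_ge0 x : 0 <= dot x x.
Proof. by apply: sumr_ge0 => i _; rewrite -expr2 sqr_ge0. Qed.

Lemma dotC x y : dot x y = dot y x.
Proof. by apply: eq_bigr => i _; rewrite mulrC. Qed.

Lemma dotZl (a : R) x y : dot (a *: x) y = a * dot x y.
Proof. by rewrite /dot mulr_sumr; apply: eq_bigr => i _; rewrite mxE mulrA. Qed.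

Lemma dot_eq0 x : dot x x = 0 -> x = 0.
Proof.
move/eqP; rewrite psumr_eq0; last by move=> i _; rewrite -expr2 sqr_ge0.
move=> /allP x0; apply/colP => i; rewrite mxE; apply/eqP.
by have := x0 i (mem_index_enum _); rewrite mulf_eq0 orbb.
Qed.

Definition qf M y : R := dot (M *m y) (M *m y).

Lemma qfE M y : qf M y = \sum_(i < 2) (\sum_(j < 2) M i j * y j 0) ^+ 2.
Proof. by apply: eq_bigr => i _; rewrite !mxE expr2. Qed.

Lemma qf_continuous M : continuous (qf M).
Proof.
have c i (y : 'cV[R]_2) : (z i 0 : R) @[z --> y] --> y i 0.
  exact: coord_continuous.
rewrite (_ : qf M = fun y =>
    (M 0 0 * y 0 0 + M 0 1 * y 1 0) * (M 0 0 * y 0 0 + M 0 1 * y 1 0) +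
    (M 1 0 * y 0 0 + M 1 1 * y 1 0) * (M 1 0 * y 0 0 + M 1 1 * y 1 0)).
  have l (a b : R) (y : 'cV[R]_2) :
      (a * z 0 0 + b * z 1 0) @[z --> y] --> a * y 0 0 + b * y 1 0.
    by apply: cvgD; apply: cvgM; [exact: cvg_cst|exact: c|exact: cvg_cst|exact: c].
  move=> y; exact: (cvgD (cvgM (l _ _ y) (l _ _ y)) (cvgM (l _ _ y) (l _ _ y))).
apply/funext => y; rewrite -!expr2 qfE !big_ord_recl !big_ord0 !addr0.
by rewrite (_ : lift ord0 ord0 = 1)//; exact/val_inj.
Qed.

Lemma boundary_ellipse M x : M \in unitmx ->
  boundary [set M *m y | y in unit_disk] x ->
  dot (invmx M *m x) (invmx M *m x) = 1.
Proof.
move=> uM.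
have -> : [set M *m y | y in unit_disk] = [set y | qf (invmx M) y <= 1].
  apply/seteqP; split => y /=.
    move=> [z]; rewrite /unit_disk /= /enorm => z1 <-.
    rewrite /qf mulKmx// -(sqr_sqrtr (dot_ge0 z)) expr_le1//.
  move=> y1; exists (invmx M *m y); last by rewrite mulKVmx.
  by rewrite /unit_disk /= /enorm -sqrtr1 ler_sqrt.
move=> [cx nix]; apply/eqP; rewrite eq_le; apply/andP; split.
  have /closure_id cl : closed [set y | qf (invmx M) y <= 1].
    by apply: (@preimage_closed _ _ (qf (invmx M)) [set r : R | r <= 1]);
      [move=> y _; exact: qf_continuous|exact: closed_le].
  by rewrite -cl in cx.
rewrite leNgt; apply/negP => lt1; apply: nix.
have o : open [set y | qf (invmx M) y < 1].
  by apply: (@open_comp _ _ (qf (invmx M)) [set r : R | r < 1]);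
    [move=> y _; exact: qf_continuous|exact: open_lt].
by apply: (@filterS _ (nbhs x) _ [set y | qf (invmx M) y < 1]);
  [move=> y /= /ltW|exact: open_nbhs_nbhs].
Qed.

(* Non-vacuity of the condition b . nu = 0: every boundary point of an ellipse
   has a unit normal. *)
Lemma unit_normal_ellipse M x : M \in unitmx ->
  boundary [set M *m y | y in unit_disk] x ->
  exists nu, unit_normal_at (boundary [set M *m y | y in unit_disk]) x nu.
Proof.
move=> uM bx; set N := invmx M; set w := N^T *m (N *m x).
have dotM y z : dot (N *m y) (N *m z) = dot (N^T *m (N *m y)) z.
  by rewrite /dot !big_ord_recl !big_ord0 /= !(mxE, big_ord_recl, big_ord0) /=; ring.
have w0 : 0 < dot w w.
  rewrite lt_neqAle dot_ge0 andbT eq_sym; apply/eqP => /dot_eq0 w0.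
  have := boundary_ellipse uM bx; rewrite dotM -/N -/w w0 /dot.
  by rewrite big1 => [/eqP|i _]; rewrite ?mxE ?mul0r// eq_sym oner_eq0.
exists ((enorm w)^-1 *: w); split.
  rewrite /enorm (_ : dot _ _ = 1) ?sqrtr1//.
  have -> : dot ((enorm w)^-1 *: w) ((enorm w)^-1 *: w) =
            (enorm w)^-1 ^+ 2 * dot w w.
    by rewrite dotZl dotC dotZl mulrA.
  rewrite exprVn sqr_sqrtr ?dot_ge0//.
  by rewrite mulVf// gt_eqF.
move=> v [g [g0 gS gv]].
have gd : derivable g 0 1 by exact: ex_derive.
have gj j : is_derive (0 : R) 1 (fun s => g s j 0 : R) (v j 0).
  apply: DeriveDef; first by move/derivable_mxP : gd => /(_ j 0).
  by rewrite -(@derive_val _ _ _ _ _ _ _ gv) derive_mx// mxE.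
have g1 : \forall s \near (0 : R), qf N (g s) = 1.
  by apply: filterS gS => s; exact: boundary_ellipse.
suff : dot w v = 0.
  by move=> wv; rewrite dotZl wv mulr0.
have h i : is_derive (0 : R) 1 (fun s => (N *m g s) i 0 : R) ((N *m v) i 0).
  rewrite (_ : (fun s => _) = (N i 0 \*: (fun s => g s 0 0 : R)) +
                              (N i 1 \*: (fun s => g s 1 0 : R))); last first.
    apply/funext => s; rewrite mxE !big_ord_recl big_ord0 addr0 /=.
    by rewrite (_ : lift ord0 ord0 = 1)//; exact/val_inj.
  apply: is_derive_eq; rewrite mxE !big_ord_recl big_ord0 addr0 /=.
  by rewrite (_ : lift ord0 ord0 = 1)//; exact/val_inj.
have D : is_derive (0 : R) 1 (fun s => qf N (g s)) (2 * dot w v).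
  rewrite (_ : (fun s => _) =
    ((fun s => (N *m g s) 0 0 : R) * (fun s => (N *m g s) 0 0 : R)) +
    ((fun s => (N *m g s) 1 0 : R) * (fun s => (N *m g s) 1 0 : R))); last first.
    apply/funext => s; rewrite /qf /dot !big_ord_recl big_ord0 addr0 /=.
    by rewrite (_ : lift ord0 ord0 = 1)//; exact/val_inj.
  apply: is_derive_eq; rewrite /w -dotM /dot !big_ord_recl big_ord0 addr0 g0.
  rewrite (_ : lift ord0 ord0 = 1); last exact/val_inj.
  rewrite /GRing.scale /=; ring.
have D0 : 'D_1 (fun s : R => qf N (g s)) (0 : R) = 0.
  by rewrite (near_eq_derive (g := cst (1 : R)) _ g1) derive_cst.
have := @derive_val _ _ _ _ _ _ _ D; rewrite D0.
by move=> /esym/eqP; rewrite mulf_eq0 pnatr_eq0 /= => /eqP.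
Qed.

End Ellipse_normal.

(* Main.v *)
Require Import Defs.
From HB Require Import structures.
From mathcomp Require Import all_boot all_order all_algebra.
From mathcomp Require Import all_classical all_reals all_analysis.
From mathcomp Require Import ring.

Set Implicit Arguments.
Unset Strict Implicit.
Unset Printing Implicit Defensive.

Import Order.TTheory GRing.Theory Num.Theory.
Import numFieldNormedType.Exports.

Local Open Scope classical_set_scope.
Local Open Scope ring_scope.

(** The velocity and the magnetic field are linear in [x], with the matrices
    [A' A^-1] and [c0 A Z A^-1], so every term of the system is a matrix applied
    to [x], and the system reduces to matrix identities.

    Since [det A = 1], [A^-1 = (cof A)^T] depends linearly on [A]; in particular
    it is differentiable, and differentiating [A^-1 A = 1] gives
    [(A^-1)' = - A^-1 A' A^-1] ([is_derive_invmx]). In [D_t u] the nonlinear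
    term [A' A^-1 A' A^-1 x] therefore cancels the derivative of [A^-1], and
    [D_t u = A'' A^-1 x] ([material_derivative_u]). The same cancellation makes
    the induction equation an identity ([material_derivative_b]). From
    [Z^2 = -1] the Lorentz force is [- c0^2 x] ([lorentz_force]), and the
    pressure gradient is [- lambda A^-T A^-1 x = - lambda (cof A) A^-1 x]
    ([grad_pressure]).
    At [x = A y] the momentum equation thus reads
    [(A'' + c0^2 A) y = lambda (cof A) y] ([momentum_equation]). It holds for
    all [y] in the unit disk if and only if the matrices agree, as the two basis
    vectors belong to the disk.

    The remaining conditions always hold. The divergences are traces: that of
    [A' A^-1] is the logarithmic derivative of [det A = 1], and [Z] has trace
    zero. The pressure vanishes where [|A^-1 x| = 1]. Finally, [b] is tangent to
    the boundary: at [x = A y] with [|y| = 1], it is the initial velocity of the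
    boundary curve [s |-> A (cos (c0 s) y + sin (c0 s) Z y)]
    ([tangent_ellipse]). *)

(** * Derivatives of matrix-valued functions *)

Section matrix_calculus.
Context {R : realType} {V : normedModType R}.

Lemma is_derive_mxP m n (F : V -> 'M[R]_(m, n)) (dF : 'M[R]_(m, n)) (x v : V) :
  is_derive x v F dF <->
  forall i j, is_derive x v (fun y => F y i j : R) (dF i j).
Proof.
split=> [HF i j|HF].
  have dvF : derivable F x v by exact: ex_derive.
  apply: DeriveDef; first exact: (derivable_mxP F x v).1.
  by rewrite -(@derive_val _ _ _ _ _ _ _ HF) derive_mx// mxE.
have dvF : derivable F x v.
  by apply/derivable_mxP => i j; exact: ex_derive.
apply: DeriveDef => //; rewrite derive_mx//; apply/matrixP => i j.
by rewrite mxE derive_val.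
Qed.

Lemma is_derive_mulmx m n k (F : V -> 'M[R]_(m, n)) (G : V -> 'M[R]_(n, k))
    dF dG (x v : V) :
  is_derive x v F dF -> is_derive x v G dG ->
  is_derive x v (fun y => F y *m G y) (dF *m G x + F x *m dG).
Proof.
move=> /is_derive_mxP HF /is_derive_mxP HG; apply/is_derive_mxP => i j.
rewrite (_ : (fun y => _) =
  \sum_(l < n) ((fun y => F y i l : R) * (fun y => G y l j : R))); last first.
  by apply/funext => y; rewrite mxE fct_sumE.
apply: is_derive_eq.
rewrite !mxE -big_split/=; apply: eq_bigr => l _.
by rewrite /GRing.scale/= addrC [G x l j * _]mulrC.
Qed.

Lemma is_derive_trmx m n (F : V -> 'M[R]_(m, n)) dF (x v : V) :
  is_derive x v F dF -> is_derive x v (fun y => (F y)^T) dF^T.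
Proof.
move=> /is_derive_mxP HF; apply/is_derive_mxP => i j.
by under eq_fun do rewrite mxE; rewrite mxE.
Qed.

Lemma is_derive_cstmulmx m n k (M : 'M[R]_(m, n)) (F : V -> 'M[R]_(n, k)) dF
    (x v : V) :
  is_derive x v F dF -> is_derive x v (fun y => M *m F y) (M *m dF).
Proof.
move=> HF; have := is_derive_mulmx (is_derive_cst M x v) HF.
by rewrite mul0mx add0r.
Qed.

Lemma is_derive_mulmxcst m n k (M : 'M[R]_(n, k)) (F : V -> 'M[R]_(m, n)) dF
    (x v : V) :
  is_derive x v F dF -> is_derive x v (fun y => F y *m M) (dF *m M).
Proof.
move=> HF; have := is_derive_mulmx HF (is_derive_cst M x v).
by rewrite mulmx0 addr0.
Qed.

End matrix_calculus.

(** * Linear vector fields and quadratic forms *)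

Section linear_field.
Context {R : realType}.
Implicit Types (M N : 'M[R]_2) (x v : 'cV[R]_2).

Lemma is_derive_linear_field m n (M : 'M[R]_(m, n)) (x v : 'cV[R]_n) :
  is_derive x v (mulmx M) (M *m v).
Proof. exact: (is_derive_cstmulmx M (is_derive_id x v)). Qed.

Lemma differentiable_linear_field m n (M : 'M[R]_(m, n)) (x : 'cV[R]_n) :
  differentiable (mulmx M : 'cV[R]_n -> 'cV[R]_m) x.
Proof.
rewrite (_ : mulmx M = \sum_(j < n) (fun y : 'cV[R]_n => y j 0 *: col j M)).
  apply: differentiable_sum => j; apply: differentiableZl.
  exact: differentiable_coord.
apply/funext => y; apply/colP => i; rewrite fct_sumE !mxE summxE.
by apply: eq_bigr => j _; rewrite !mxE mulrC.
Qed.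

Lemma advect_linear_field M (w : 'cV[R]_2 -> 'cV[R]_2) x :
  advect w (mulmx M) x = M *m w x.
Proof.
rewrite /advect [in RHS](matrix_sum_delta (w x)) mulmx_sumr.
apply: eq_bigr => j _; rewrite big_ord1 -scalemxAr; congr (_ *: _).
have := is_derive_linear_field M x (base j).
by move=> /(@derive_val _ _ _ _ _ _ _).
Qed.

Lemma divergence_linear_field M x : divergence (mulmx M) x = \tr M.
Proof.
apply: eq_bigr => j _.
have /is_derive_mxP/(_ j 0) := is_derive_linear_field M x (base j).
by move=> /(@derive_val _ _ _ _ _ _ _) ->; rewrite -colE mxE.
Qed.

Lemma dotE x v : dot x v = (x^T *m v) 0 0.
Proof. by rewrite mxE; apply: eq_bigr => i _; rewrite mxE. Qed.

Lemma enorm_sqr x : enorm x ^+ 2 = dot x x.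
Proof. by rewrite sqr_sqrtr// dot_ge0. Qed.

Lemma is_derive_qf N x v :
  is_derive x v (qf N) (2 * dot (N^T *m (N *m x)) v).
Proof.
have D := is_derive_linear_field N x v.
have := is_derive_mulmx (is_derive_trmx D) D.
move=> /is_derive_mxP/(_ 0 0).
rewrite (_ : (fun y => _) = qf N); last by apply/funext => y; rewrite /qf dotE.
move=> H; apply: is_derive_eq; rewrite mxE -!dotE dotC -mulr2n mulr_natl.
by rewrite !dotE !trmx_mul trmxK !mulmxA.
Qed.

Lemma differentiable_qf N x : differentiable (qf N) x.
Proof.
rewrite (_ : qf N = \sum_(i < 2) ((fun y => (N *m y) i 0) * (fun y => (N *m y) i 0))).
  apply: differentiable_sum => i.
  by apply: differentiableM; apply: (@differentiable_comp _ _ _ _ (mulmx N)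
    (fun z : 'cV[R]_2 => z i 0 : R));
    [exact: differentiable_linear_field|exact: differentiable_coord
    |exact: differentiable_linear_field|exact: differentiable_coord].
by apply/funext => y; rewrite fct_sumE.
Qed.

End linear_field.

(** * Cofactors and curves of unimodular matrices *)

Section unimodular.
Context {R : realType}.
Implicit Types (M X Y : 'M[R]_2).

Lemma Zmx_tr : (Zmx : 'M[R]_2)^T = - Zmx.
Proof. by rewrite /Zmx linearB/= !trmx_delta opprB. Qed.

Lemma mxtrace_Zmx : \tr (Zmx : 'M[R]_2) = 0.
Proof. by rewrite /mxtrace !big_ord_recl big_ord0 !mxE/= subrr !addr0. Qed.

Lemma cof_tr M : (cof M)^T = Zmx *m M^T *m Zmx^T.
Proof. by rewrite /cof !trmx_mul trmxK mulmxA. Qed.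

Lemma matrix22P X Y : X 0 0 = Y 0 0 -> X 0 1 = Y 0 1 ->
  X 1 0 = Y 1 0 -> X 1 1 = Y 1 1 -> X = Y.
Proof.
move=> e00 e01 e10 e11.
have I2 (i : 'I_2) : i = 0 \/ i = 1.
  by case: i => -[|[|//]] ?; [left|right]; exact: val_inj.
by apply/matrixP => i j; have [->|->] := I2 i; have [->|->] := I2 j.
Qed.

Lemma mulZZ : Zmx *m Zmx = - 1%:M :> 'M[R]_2.
Proof.
by apply: matrix22P; rewrite !(mxE, big_ord_recl, big_ord0)/= ?mulr0n ?mulr1n; ring.
Qed.

Lemma mul_cof_tr M : M *m (cof M)^T = (\det M)%:M.
Proof.
have l01 : lift ord0 ord0 = 1 :> 'I_2 by exact: val_inj.
have l10 : lift (1 : 'I_2) ord0 = 0 by exact: val_inj.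
rewrite cof_tr (expand_det_row _ 0) !big_ord_recl big_ord0 /cofactor !det_mx11.
by apply: matrix22P; rewrite !(mxE, big_ord_recl, big_ord0)/= !l01 ?l10
  ?mulr0n ?mulr1n; ring.
Qed.

Lemma unitmx_det1 M : \det M = 1 -> M \in unitmx.
Proof. by move=> M1; rewrite unitmxE M1 unitr1. Qed.

Lemma invmx_cof M : \det M = 1 -> invmx M = (cof M)^T.
Proof.
move=> M1; have uM := unitmx_det1 M1.
by rewrite -[LHS]mulmx1 -M1 -mul_cof_tr mulKmx.
Qed.

Lemma cof_invmx M : \det M = 1 -> cof M = (invmx M)^T.
Proof. by move=> /invmx_cof ->; rewrite trmxK. Qed.

(** Both sides are the symmetric bilinear form whose value at [(X, X)] is
    [2 * \det X]. *)
Lemma mxtrace_cof_sym X Y : \tr ((cof X)^T *m Y) = \tr ((cof Y)^T *m X).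
Proof.
rewrite -mxtrace_tr trmx_mul trmxK !cof_tr /cof.
by rewrite !mulmxA mxtrace_mulC Zmx_tr !mulmxA !mulNmx !mulmxN mulNmx.
Qed.

Variable A : R -> 'M[R]_2.
Hypothesis A1 : forall t, \det (A t) = 1.
Variables (t : R) (dA : 'M[R]_2).
Hypothesis HA : is_derive t (1 : R) A dA.

(** By [invmx_cof] the inverse is a linear function of [A s]. *)
Lemma is_derive_invmx_cof :
  is_derive t (1 : R) (fun s => invmx (A s)) (cof dA)^T.
Proof.
under eq_fun do rewrite invmx_cof// cof_tr.
rewrite cof_tr; apply: is_derive_mulmxcst; apply: is_derive_cstmulmx.
exact: is_derive_trmx.
Qed.

Lemma cof_tr_derive : (cof dA)^T = - (invmx (A t) *m dA *m invmx (A t)).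
Proof.
have uA : A t \in unitmx by exact: unitmx_det1.
have := is_derive_mulmx is_derive_invmx_cof HA.
rewrite (_ : (fun s => _) = cst 1%:M); last first.
  by apply/funext => s /=; rewrite mulVmx// unitmx_det1.
move=> /(@derive_val _ _ _ _ _ _ _); rewrite derive_cst => /esym/eqP.
by rewrite addr_eq0 => /eqP e; rewrite -[LHS](mulmxK uA) e mulNmx.
Qed.

Lemma is_derive_invmx :
  is_derive t (1 : R) (fun s => invmx (A s))
    (- (invmx (A t) *m dA *m invmx (A t))).
Proof. by rewrite -cof_tr_derive; exact: is_derive_invmx_cof. Qed.

(** Jacobi's formula for the derivative of the constant [\det (A s)]. *)
Lemma mxtrace_velocity_gradient : \tr (dA *m invmx (A t)) = 0.
Proof.
have uA : A t \in unitmx by exact: unitmx_det1.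
have := mxtrace_cof_sym dA (A t).
rewrite cof_tr_derive -invmx_cof// mulNmx mulmxKV// linearN/= mxtrace_mulC.
by move/eqP; rewrite eq_sym -addr_eq0 -mulr2n mulrn_eq0/= => /eqP.
Qed.

End unimodular.

(** * The boundary of an ellipse and its tangents *)

Section boundary.
Context {R : realType}.
Implicit Types (M : 'M[R]_2) (x y nu : 'cV[R]_2).

Lemma dot_rotation (a b : R) y : a ^+ 2 + b ^+ 2 = 1 ->
  dot (a *: y + b *: (Zmx *m y)) (a *: y + b *: (Zmx *m y)) = dot y y.
Proof.
move=> ab; rewrite -[RHS]mul1r -ab /dot !(mxE, big_ord_recl, big_ord0)/=.
have -> : lift ord0 ord0 = 1 :> 'I_2 by exact: val_inj.
by ring.
Qed.

Lemma boundary_ellipse_image M y : M \in unitmx -> dot y y = 1 ->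
  boundary [set M *m z | z in unit_disk] (M *m y).
Proof.
move=> uM y1; split.
  by apply: subset_closure; exists y => //=; rewrite /unit_disk/= /enorm y1 sqrtr1.
rewrite /interior/= => nbO.
(* If M y were interior, (1 + s) M y would be in the ellipse for some s > 0,
   although (1 + s) y is outside the disk. *)
have cs : (fun s : R => (1 + s) *: (M *m y)) @ 0 --> M *m y.
  rewrite -[X in _ --> X]scale1r -{2}[1]addr0.
  by apply: cvgZr_tmp; apply: cvgD; [exact: cvg_cst|exact: cvg_id].
have /nbhs_ballP[e /= e0 He] := cs _ nbO.
have /He/= [z z1] : ball (0 : R) e (e / 2).
  by rewrite /ball/= sub0r normrN gtr0_norm ?divr_gt0// ltr_pdivrMr// ltr_pMr// ltr1n.
rewrite scalemxAr => /(can_inj (mulKmx uM)) zE.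
move: z1; rewrite /unit_disk/= /enorm zE dotZl dotC dotZl y1 mulr1.
rewrite -[1 in X in _ <= X -> _]sqrtr1 ler_sqrt// -expr2 expr_le1//.
  by rewrite gerDl leNgt divr_gt0.
by rewrite addr_ge0// divr_ge0// ltW.
Qed.

Lemma tangent_ellipse M (c : R) y : M \in unitmx -> dot y y = 1 ->
  tangent_at (boundary [set M *m z | z in unit_disk]) (M *m y)
    (c *: (M *m Zmx *m y)).
Proof.
move=> uM y1.
exists (fun s => M *m (cos (c * s) *: y + sin (c * s) *: (Zmx *m y))); split.
- by rewrite mulr0 cos0 sin0 scale1r scale0r addr0.
- apply: filterE => s; apply: boundary_ellipse_image => //.
  by rewrite dot_rotation// cos2Dsin2.
rewrite -mulmxA scalemxAr; apply: is_derive_cstmulmx.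
apply/is_derive_mxP => i j; rewrite (ord1 j).
have Dc : is_derive (0 : R) 1 (fun s : R => c * s) c.
  rewrite (_ : (fun s => _) = c *: id)//; apply: is_derive_eq.
  by rewrite /GRing.scale/= mulr1.
have C : is_derive (0 : R) 1 (fun s : R => cos (c * s)) 0.
  have := is_derive1_comp (is_derive_cos (c * 0)) Dc.
  by rewrite mulr0 sin0 oppr0 mul0r.
have S : is_derive (0 : R) 1 (fun s : R => sin (c * s)) c.
  have := is_derive1_comp (is_derive_sin (c * 0)) Dc.
  by rewrite mulr0 cos0 mul1r.
rewrite (_ : (fun s => _) =
    y i 0 *: (fun s : R => cos (c * s)) +
    (Zmx *m y) i 0 *: (fun s : R => sin (c * s))); last first.
  by apply/funext => s; rewrite mxE [X in X + _]mxE [X in _ + X]mxE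
    mulrC [X in _ + X]mulrC.
apply: (is_derive_eq (is_deriveD (is_deriveZ (y i 0) C)
  (is_deriveZ ((Zmx *m y) i 0) S))).
by rewrite scaler0 add0r [RHS]mxE /GRing.scale/= mulrC.
Qed.

End boundary.

(** * The MHD equations for the affine motion *)

Section affine_motion.
Context {R : realType}.
Implicit Types (A : R -> 'M[R]_2) (lambda : R -> R) (t : R) (x : 'cV[R]_2).

(** The Eulerian velocity of the flow [x |-> A t *m x]. *)
Definition affine_velocity A t x : 'cV[R]_2 :=
  A^`()%classic t *m invmx (A t) *m x.

(** The image under the flow of the rotation field [y |-> c0 *: (Zmx *m y)]. *)
Definition affine_magnetic A (c0 : R) t x : 'cV[R]_2 :=
  c0 *: (A t *m Zmx *m invmx (A t) *m x).

(** The pressure constant on the ellipses [|A^-1 x| = r], zero for [r = 1]. *)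
Definition affine_pressure A lambda t x : R :=
  2^-1 * lambda t * (1 - enorm (invmx (A t) *m x) ^+ 2).

(** The ellipse occupied by the fluid. *)
Definition fluid_domain A t : set 'cV[R]_2 := [set A t *m x | x in unit_disk].

End affine_motion.

Section equations.
Context {R : realType}.
Variables (A : R -> 'M[R]_2) (lambda : R -> R) (c0 : R).
Hypotheses (A1 : forall t, \det (A t) = 1) (A_C2 : C2_path A).
Local Notation dA := (A^`()%classic).
Local Notation ddA := (A^`()^`()%classic).
Local Notation u := (affine_velocity A).
Local Notation b := (affine_magnetic A c0).
Local Notation p := (affine_pressure A lambda).
Local Notation Omega := (fluid_domain A).

Let uA t : A t \in unitmx. Proof. exact: unitmx_det1. Qed.

Let DA t : is_derive t (1 : R) A (dA t).
Proof. by have [dvA _ _] := A_C2; rewrite derive1E; exact: derivableP. Qed.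

Let DdA t : is_derive t (1 : R) dA (ddA t).
Proof. by have [_ dvA _] := A_C2; rewrite derive1E; exact: derivableP. Qed.

Let b_linear t : b t = mulmx (c0 *: (A t *m Zmx *m invmx (A t))).
Proof. by apply/funext => x; rewrite -scalemxAl. Qed.

Let p_qf t : p t = (2^-1 * lambda t) *: (cst 1 - qf (invmx (A t))).
Proof. by apply/funext => x; rewrite /affine_pressure enorm_sqr. Qed.

Let Du t x : is_derive t (1 : R) (fun s => u s x)
  ((ddA t *m invmx (A t) - dA t *m invmx (A t) *m dA t *m invmx (A t)) *m x).
Proof.
apply: is_derive_mulmxcst.
apply: (is_derive_eq (is_derive_mulmx (DdA t) (is_derive_invmx A1 (DA t)))).
by rewrite mulmxN !mulmxA.
Qed.

Let Db t x : is_derive t (1 : R) (fun s => b s x)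
  (c0 *: ((dA t *m Zmx *m invmx (A t)
     - A t *m Zmx *m invmx (A t) *m dA t *m invmx (A t)) *m x)).
Proof.
apply: is_deriveZ; apply: is_derive_mulmxcst.
apply: (is_derive_eq (is_derive_mulmx (is_derive_mulmxcst Zmx (DA t))
  (is_derive_invmx A1 (DA t)))).
by rewrite mulmxN !mulmxA.
Qed.

Lemma MHD_regular t x : MHD_regular_at u b p t x.
Proof.
split.
- exact: ex_derive.
- exact: ex_derive.
- exact: differentiable_linear_field.
- by rewrite b_linear; exact: differentiable_linear_field.
- rewrite p_qf; apply: differentiableZ; apply: differentiableB => //.
  exact: differentiable_qf.
Qed.

Lemma material_derivative_u t x :
  material_derivative u u t x = ddA t *m invmx (A t) *m x.
Proof.
rewrite /material_derivative derive1E (@derive_val _ _ _ _ _ _ _ (Du t x)).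
by rewrite advect_linear_field /affine_velocity !mulmxA mulmxBl subrK.
Qed.

Lemma material_derivative_b t x :
  material_derivative u b t x = advect (b t) (u t) x.
Proof.
rewrite /material_derivative derive1E (@derive_val _ _ _ _ _ _ _ (Db t x)).
rewrite b_linear !advect_linear_field /affine_velocity -!scalemxAl -!scalemxAr -scalerDr.
by congr (_ *: _); rewrite !mulmxA mulmxBl subrK mulmxKV.
Qed.

Lemma lorentz_force t x : advect (b t) (b t) x = - (c0 ^+ 2) *: x.
Proof.
rewrite {2}b_linear advect_linear_field /affine_magnetic -scalemxAl -scalemxAr scalerA -expr2.
rewrite scaleNr -scalerN; congr (_ *: _).
rewrite !mulmxA mulmxKV// -(mulmxA (A t)) mulZZ mulmxN mulmx1.
by rewrite !mulNmx mulmxV// mul1mx.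
Qed.

Lemma grad_pressure t x :
  grad (p t) x = - lambda t *: (cof (A t) *m (invmx (A t) *m x)).
Proof.
apply/colP => j; rewrite cof_invmx// !mxE.
have D := is_derive_qf (invmx (A t)) x (base j).
rewrite p_qf.
have H : is_derive x (base j)
   ((2^-1 * lambda t) *: (cst 1 - qf (invmx (A t))) : _ -> R)
   ((2^-1 * lambda t) *: (0 - 2 * dot ((invmx (A t))^T *m (invmx (A t) *m x)) (base j))).
  exact: is_deriveZ.
rewrite (@derive_val _ _ _ _ _ _ _ H) sub0r dotE -colE mxE mxE mxE.
by rewrite /GRing.scale/=; field.
Qed.

(** The momentum equation in the Lagrangian coordinate [y]. *)
Lemma momentum_equation t y :
  material_derivative u u t (A t *m y) =
    - grad (p t) (A t *m y) + advect (b t) (b t) (A t *m y) <->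
  (ddA t + c0 ^+ 2 *: A t) *m y = (lambda t *: cof (A t)) *m y.
Proof.
rewrite material_derivative_u lorentz_force grad_pressure mulKmx//.
rewrite mulmxA mulmxKV// scaleNr opprK scaleNr mulmxDl -!scalemxAl.
by split=> [->|<-]; rewrite ?subrK ?addrK.
Qed.

Lemma divergence_u t x : divergence (u t) x = 0.
Proof.
by rewrite divergence_linear_field (mxtrace_velocity_gradient A1 (DA t)).
Qed.

Lemma divergence_b t x : divergence (b t) x = 0.
Proof.
rewrite b_linear divergence_linear_field linearZ/= mxtrace_mulC mulmxA.
by rewrite mulVmx// mul1mx mxtrace_Zmx mulr0.
Qed.

Lemma MHD_equations t y :
  MHD_equations_at u b p t (A t *m y) <->
  (ddA t + c0 ^+ 2 *: A t) *m y = (lambda t *: cof (A t)) *m y.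
Proof.
split=> [[momentum _ _ _]|ode]; first exact/momentum_equation.
split; [exact/momentum_equation|exact: material_derivative_b
  |exact: divergence_u|exact: divergence_b].
Qed.

(** No equation on the second derivative of [A] is needed here. *)
Lemma MHD_boundary t x : boundary (Omega t) x -> MHD_boundary_at b p Omega t x.
Proof.
move=> bx; have y1 := boundary_ellipse (uA t) bx; split.
  by rewrite /affine_pressure enorm_sqr y1 subrr mulr0.
move=> nu [_ nuT]; rewrite dotC; apply: nuT.
have := tangent_ellipse c0 (uA t) y1.
by rewrite mulKVmx// mulmxA.
Qed.

End equations.

Theorem lemma4p5 (R : realType) (A : R -> 'M[R]_2) (lambda : R -> R)
    (c0 kappa : R)
    (hA_SL : forall t, \det (A t) = 1) (hA_C0 : continuous A)
    (hA_C2 : C2_path A)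
    (hlambda : continuous lambda)
    (hkappa : kappa = c0 ^+ 2) :
  let u := fun (t : R) (x : 'cV[R]_2) => A^`()%classic t *m invmx (A t) *m x in
  let b := fun (t : R) (x : 'cV[R]_2) =>
    c0 *: (A t *m Zmx *m invmx (A t) *m x) in
  let p := fun (t : R) (x : 'cV[R]_2) =>
    2^-1 * lambda t * (1 - enorm (invmx (A t) *m x) ^+ 2) in
  let Omega := fun t : R => [set A t *m x | x in unit_disk] in
  MHD_solution u b p Omega <->
  (forall t, A^`()^`()%classic t + kappa *: A t = lambda t *: cof (A t)).
Proof.
move=> u b p Omega; rewrite hkappa; split=> [[sol _] t|ode].
  have disk_base j : unit_disk (base j : 'cV[R]_2).
    rewrite /unit_disk/= /enorm dotE trmx_delta mul_delta_mx mxE !eqxx.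
    by rewrite sqrtr1.
  (* The momentum equation at the image of the j-th basis vector gives the j-th
     column of the matrix equation. *)
  apply/trmx_inj/row_matrixP => j; rewrite -!tr_col; congr (_^T); rewrite !colE.
  apply: (MHD_equations lambda c0 hA_SL hA_C2 t (base j)).1.
  by have [] := sol t (A t *m base j) (imageP _ (disk_base j)).
split=> t x.
  move=> [y _ <-]; split; first exact: MHD_regular.
  by apply: (MHD_equations lambda c0 hA_SL hA_C2 t y).2; rewrite ode.
exact: MHD_boundary.
Qed.
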